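(* Let $X$ be a locally complete preordered set. A morphism $p\colon (E,\varepsilon)\to (B,\beta)$ in $\mathsf{Ord}//X$ is an effective descent morphism in $\mathsf{Ord}//X$ provided that both of the following hold: (a) for all $b_2\leqslant b_1\leqslant b_0$ in $B$, there exist $e_2\leqslant e_1\leqslant e_0$ in $E$ with $p(e_i)=b_i$ for each $i=0,1,2$; (b$'$) for each $x\in X$ and all $b_1\leqslant b_0$ in $B$ with $x\leqslant\beta(b_1)$, there exist $e_1\leqslant e_0$ in $E$ with $x\leqslant\varepsilon(e_1)$ and $p(e_i)=b_i$ for $i=0,1$.
   Context: A preorder (preordered set) is a set equipped with a reflexive transitive relation $\leqslant$; $\mathsf{Ord}$ is the category of preorders and monotone maps. A preorder $X$ is locally complete if, for each $x\in X$, the preorder $\{x'\in X\mid x'\leqslant x\}$ is equivalent (as a category) to a complete lattice. The lax comma category $\mathsf{Ord}//X$ has as objects pairs $(A,\alpha)$ with $A$ a preorder and $\alpha\colon A\to X$ a monotone map; a morphism $f\colon(A,\alpha)\to(B,\beta)$ is a monotone map $f\colon A\to B$ with $\alpha(a)\leqslant\beta(f(a))$ for all $a\in A$. When $X$ is locally complete, $\mathsf{Ord}//X$ has pullbacks. In a category $\mathcal{C}$ with pullbacks, a morphism $p\colon E\to B$ is an effective descent morphism (is effective for descent) if the pullback functor $p^*\colon(\mathcal{C}\downarrow B)\to(\mathcal{C}\downarrow E)$ is monadic, i.e. the comparison functor from $(\mathcal{C}\downarrow B)$ to the category of algebras of the monad on $(\mathcal{C}\downarrow E)$ induced by $p_!\dashv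 p^*$ is an equivalence of categories. *)

(* Defs.v *)
From Stdlib Require Import RelationClasses ProofIrrelevance FunctionalExtensionality ClassicalEpsilon.

Set Implicit Arguments.
Unset Strict Implicit.
Unset Printing Implicit Defensive.

Declare Scope cat_scope.
Delimit Scope cat_scope with cat.
Open Scope cat_scope.

Record category := Category {
  obj :> Type;
  hom : obj -> obj -> Type;
  ident : forall A, hom A A;
  comp : forall A B C, hom B C -> hom A B -> hom A C;
  comp_id_l : forall A B (f : hom A B), comp (ident B) f = f;
  comp_id_r : forall A B (f : hom A B), comp f (ident A) = f;
  comp_assoc : forall A B C D (h : hom C D) (g : hom B C) (f : hom A B),
    comp h (comp g f) = comp (comp h g) f
}.

Arguments hom {c} A B.
Arguments ident {c} A.
Arguments comp {c A B C} g f.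

Notation "g ∘ f" := (comp g f) (at level 40, left associativity) : cat_scope.

Definition is_iso (C : category) (A B : C) (f : hom A B) : Prop :=
  exists g : hom B A, g ∘ f = ident A /\ f ∘ g = ident B.

Record functor (C D : category) := Functor {
  fobj :> C -> D;
  fmap : forall A B, hom A B -> hom (fobj A) (fobj B);
  fmap_id : forall A, fmap (ident A) = ident (fobj A);
  fmap_comp : forall A B E (g : hom B E) (f : hom A B),
    fmap (g ∘ f) = fmap g ∘ fmap f
}.

Arguments fmap {C D} F {A B} f : rename.

Program Definition id_functor (C : category) : functor C C :=
  {| fobj := fun A => A; fmap := fun A B f => f |}.

Program Definition comp_functor (C D E : category)
    (G : functor D E) (F : functor C D) : functor C E :=
  {| fobj := fun A => G (F A); fmap := fun A B f => fmap G (fmap F f) |}.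
Next Obligation. now rewrite !fmap_id. Qed.
Next Obligation. now rewrite !fmap_comp. Qed.

Record nat_trans (C D : category) (F G : functor C D) := NatTrans {
  component :> forall A : C, hom (F A) (G A);
  naturality : forall A B (f : hom A B),
    component B ∘ fmap F f = fmap G f ∘ component A
}.

Definition naturally_isomorphic (C D : category) (F G : functor C D) : Prop :=
  exists t : nat_trans F G, forall A, is_iso (t A).

Definition is_equivalence (C D : category) (F : functor C D) : Prop :=
  exists G : functor D C,
    naturally_isomorphic (comp_functor G F) (id_functor C) /\
    naturally_isomorphic (comp_functor F G) (id_functor D).

Definition equivalent_categories (C D : category) : Prop :=
  exists F : functor C D, is_equivalence F.

Record adjunction (C D : category) (L : functor C D) (R : functor D C) := Adjunction {
  unit : nat_trans (id_functor C) (comp_functor R L);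
  counit : nat_trans (comp_functor L R) (id_functor D);
  triangle_l : forall A : C, counit (L A) ∘ fmap L (unit A) = ident (L A);
  triangle_r : forall B : D, fmap R (counit B) ∘ unit (R B) = ident (R B)
}.

Arguments unit {C D L R} a.
Arguments counit {C D L R} a.

Record monad (C : category) := Monad {
  endo :> functor C C;
  eta : nat_trans (id_functor C) endo;
  mu : nat_trans (comp_functor endo endo) endo;
  mu_eta_l : forall A, mu A ∘ eta (endo A) = ident (endo A);
  mu_eta_r : forall A, mu A ∘ fmap endo (eta A) = ident (endo A);
  mu_assoc : forall A, mu A ∘ fmap endo (mu A) = mu A ∘ mu (endo A)
}.

Arguments eta {C} T : rename.
Arguments mu {C} T : rename.

Program Definition adjunction_monad (C D : category) (L : functor C D) (R : functor D C)
    (adj : adjunction L R) : monad C :=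
  {| endo := comp_functor R L;
     eta := unit adj;
     mu := {| component := fun A => fmap R (counit adj (L A)) |} |}.
Next Obligation.
  rewrite <- !fmap_comp. f_equal. exact (naturality (counit adj) (fmap L f)).
Qed.
Next Obligation. exact (triangle_r adj (L A)). Qed.
Next Obligation. rewrite <- fmap_comp. etransitivity; [apply f_equal, triangle_l | apply fmap_id]. Qed.
Next Obligation.
  rewrite <- !fmap_comp. f_equal.
  exact (naturality (counit adj) (counit adj (L A))).
Qed.

Record algebra (C : category) (T : monad C) := Algebra {
  alg_carrier : C;
  alg_action : hom (T alg_carrier) alg_carrier;
  alg_unit : alg_action ∘ eta T alg_carrier = ident alg_carrier;
  alg_assoc : alg_action ∘ mu T alg_carrier = alg_action ∘ fmap T alg_action
}.

Record algebra_hom (C : category) (T : monad C) (A B : algebra T) := AlgebraHom {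
  alg_hom : hom (alg_carrier A) (alg_carrier B);
  alg_hom_action : alg_hom ∘ alg_action A = alg_action B ∘ fmap T alg_hom
}.

Lemma algebra_hom_eq (C : category) (T : monad C) (A B : algebra T)
    (f g : algebra_hom A B) : alg_hom f = alg_hom g -> f = g.
Proof.
  destruct f as [f Hf], g as [g Hg]; simpl; intros <-.
  f_equal; apply proof_irrelevance.
Qed.

Program Definition algebra_category (C : category) (T : monad C) : category :=
  {| obj := algebra T;
     hom := @algebra_hom C T;
     ident := fun A => {| alg_hom := ident (alg_carrier A) |};
     comp := fun A B D g f => {| alg_hom := alg_hom g ∘ alg_hom f |} |}.
Next Obligation. now rewrite fmap_id, comp_id_l, comp_id_r. Qed.
Next Obligation.
  now rewrite fmap_comp, <- comp_assoc, alg_hom_action, comp_assoc, alg_hom_action,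
    comp_assoc.
Qed.
Next Obligation. apply algebra_hom_eq, comp_id_l. Qed.
Next Obligation. apply algebra_hom_eq, comp_id_r. Qed.
Next Obligation. apply algebra_hom_eq, comp_assoc. Qed.

Program Definition comparison_functor (C D : category) (L : functor C D) (R : functor D C)
    (adj : adjunction L R) : functor D (algebra_category (adjunction_monad adj)) :=
  {| fobj := fun Y => {| alg_carrier := R Y; alg_action := fmap R (counit adj Y) |};
     fmap := fun Y Z f => {| alg_hom := fmap R f |} |}.
Next Obligation. exact (triangle_r adj Y). Qed.
Next Obligation.
  rewrite <- !fmap_comp. f_equal. symmetry. exact (naturality (counit adj) (counit adj Y)).
Qed.
Next Obligation.
  rewrite <- !fmap_comp. f_equal. symmetry. exact (naturality (counit adj) f).
Qed.
Next Obligation. apply algebra_hom_eq, fmap_id. Qed.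
Next Obligation. apply algebra_hom_eq, fmap_comp. Qed.

Definition monadic (C D : category) (L : functor C D) (R : functor D C)
    (adj : adjunction L R) : Prop :=
  is_equivalence (comparison_functor adj).

Record slice_obj (C : category) (B : C) := SliceObj {
  slice_dom : C;
  slice_map : hom slice_dom B
}.

Record slice_hom (C : category) (B : C) (X Y : slice_obj B) := SliceHom {
  slice_mor : hom (slice_dom X) (slice_dom Y);
  slice_comm : slice_map Y ∘ slice_mor = slice_map X
}.

Lemma slice_hom_eq (C : category) (B : C) (X Y : slice_obj B)
    (f g : slice_hom X Y) : slice_mor f = slice_mor g -> f = g.
Proof.
  destruct f as [f Hf], g as [g Hg]; simpl; intros <-.
  f_equal; apply proof_irrelevance.
Qed.

Program Definition slice (C : category) (B : C) : category :=
  {| obj := slice_obj B;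
     hom := @slice_hom C B;
     ident := fun X => {| slice_mor := ident (slice_dom X) |};
     comp := fun X Y Z g f => {| slice_mor := slice_mor g ∘ slice_mor f |} |}.
Next Obligation. apply comp_id_r. Qed.
Next Obligation. now rewrite comp_assoc, !slice_comm. Qed.
Next Obligation. apply slice_hom_eq, comp_id_l. Qed.
Next Obligation. apply slice_hom_eq, comp_id_r. Qed.
Next Obligation. apply slice_hom_eq, comp_assoc. Qed.

Record pullback (C : category) (A B D : C) (f : hom A D) (g : hom B D) := Pullback {
  pb_obj : C;
  pb_fst : hom pb_obj A;
  pb_snd : hom pb_obj B;
  pb_comm : f ∘ pb_fst = g ∘ pb_snd;
  pb_lift : forall Z (u : hom Z A) (v : hom Z B), f ∘ u = g ∘ v -> hom Z pb_obj;
  pb_lift_fst : forall Z (u : hom Z A) (v : hom Z B) (H : f ∘ u = g ∘ v),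
    pb_fst ∘ pb_lift H = u;
  pb_lift_snd : forall Z (u : hom Z A) (v : hom Z B) (H : f ∘ u = g ∘ v),
    pb_snd ∘ pb_lift H = v;
  pb_unique : forall Z (w w' : hom Z pb_obj),
    pb_fst ∘ w = pb_fst ∘ w' -> pb_snd ∘ w = pb_snd ∘ w' -> w = w'
}.

Definition chosen_pullbacks (C : category) : Type :=
  forall (A B D : C) (f : hom A D) (g : hom B D), pullback f g.

Definition has_pullbacks (C : category) : Prop := inhabited (chosen_pullbacks C).

Program Definition postcomp_functor (C : category) (E B : C) (p : hom E B) :
    functor (slice E) (slice B) :=
  {| fobj := fun X => {| slice_map := p ∘ slice_map X |} : slice B;
     fmap := fun X Y f => {| slice_mor := slice_mor f |} |}.
Next Obligation. now rewrite <- comp_assoc, slice_comm. Qed.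
Next Obligation. now apply slice_hom_eq. Qed.
Next Obligation. now apply slice_hom_eq. Qed.

Lemma pullback_functor_comm (C : category) (pb : chosen_pullbacks C) (E B : C)
    (p : hom E B) (X Y : slice B) (f : hom X Y) :
  p ∘ pb_fst (pb _ _ _ p (slice_map X))
  = slice_map Y ∘ (slice_mor f ∘ pb_snd (pb _ _ _ p (slice_map X))).
Proof. now rewrite comp_assoc, slice_comm, pb_comm. Qed.

Program Definition pullback_functor (C : category) (pb : chosen_pullbacks C)
    (E B : C) (p : hom E B) : functor (slice B) (slice E) :=
  {| fobj := fun X => {| slice_map := pb_fst (pb _ _ _ p (slice_map X)) |} : slice E;
     fmap := fun X Y f =>
       {| slice_mor := pb_lift (pb _ _ _ p (slice_map Y)) (pullback_functor_comm pb p f) |} |}.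
Next Obligation. apply pb_lift_fst. Qed.
Next Obligation.
  apply slice_hom_eq; simpl; apply pb_unique;
    [rewrite pb_lift_fst | rewrite pb_lift_snd, comp_id_l]; now rewrite comp_id_r.
Qed.
Next Obligation.
  apply slice_hom_eq; simpl; apply pb_unique; rewrite comp_assoc.
  - now rewrite !pb_lift_fst.
  - now rewrite !pb_lift_snd, <- !comp_assoc, pb_lift_snd.
Qed.

Lemma pullback_unit_comm (C : category) (E B : C) (p : hom E B) (X : slice E) :
  p ∘ slice_map X = (p ∘ slice_map X) ∘ ident (slice_dom X).
Proof. now rewrite comp_id_r. Qed.

Program Definition pullback_adjunction (C : category) (pb : chosen_pullbacks C)
    (E B : C) (p : hom E B) : adjunction (postcomp_functor p) (pullback_functor pb p) :=
  {| unit := {| component := fun X =>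
       {| slice_mor := pb_lift (pb _ _ _ p (p ∘ slice_map X)) (pullback_unit_comm p X) |} |};
     counit := {| component := fun Y =>
       {| slice_mor := pb_snd (pb _ _ _ p (slice_map Y)) |} |} |}.
Next Obligation. apply pb_lift_fst. Qed.
Next Obligation.
  apply slice_hom_eq; simpl; apply pb_unique; rewrite !comp_assoc.
  - now rewrite !pb_lift_fst, slice_comm.
  - now rewrite !pb_lift_snd, <- comp_assoc, pb_lift_snd, comp_id_l, comp_id_r.
Qed.
Next Obligation. symmetry. apply pb_comm. Qed.
Next Obligation. apply slice_hom_eq; simpl. apply pb_lift_snd. Qed.
Next Obligation. apply slice_hom_eq; simpl. apply pb_lift_snd. Qed.
Next Obligation.
  apply slice_hom_eq; simpl; apply pb_unique; rewrite comp_assoc, comp_id_r.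
  - now rewrite !pb_lift_fst.
  - now rewrite pb_lift_snd, <- comp_assoc, pb_lift_snd, comp_id_r.
Qed.

(* The pullback functor depends on the choice of pullbacks, but only up to
   isomorphism, so all choices give the same notion; the first conjunct keeps it
   from being vacuous. *)
Definition effective_descent (C : category) (E B : C) (p : hom E B) : Prop :=
  has_pullbacks C /\
  forall pb : chosen_pullbacks C, monadic (pullback_adjunction pb p).

Record preorder := Preorder {
  carrier :> Type;
  le : carrier -> carrier -> Prop;
  le_preorder : PreOrder le
}.

Arguments le {p} x y : rename.
#[export] Existing Instance le_preorder.

Notation "x ≤ y" := (le x y) (at level 70, no associativity) : cat_scope.

Program Definition preorder_category (X : preorder) : category :=
  {| obj := X; hom := fun x y => x ≤ y;
     ident := fun x => reflexivity x;
     comp := fun x y z g f => transitivity f g |}.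
Next Obligation. apply proof_irrelevance. Qed.
Next Obligation. apply proof_irrelevance. Qed.
Next Obligation. apply proof_irrelevance. Qed.

Program Definition down (X : preorder) (x : X) : preorder :=
  {| carrier := {x' : X | x' ≤ x};
     le := fun y z => proj1_sig y ≤ proj1_sig z |}.
Next Obligation.
  split; [intros y; reflexivity | intros y z t; apply transitivity].
Qed.

Definition is_lub (L : preorder) (S : L -> Prop) (s : L) : Prop :=
  (forall y, S y -> y ≤ s) /\ (forall t, (forall y, S y -> y ≤ t) -> s ≤ t).

Definition is_glb (L : preorder) (S : L -> Prop) (s : L) : Prop :=
  (forall y, S y -> s ≤ y) /\ (forall t, (forall y, S y -> t ≤ y) -> t ≤ s).

Definition is_complete_lattice (L : preorder) : Prop :=
  (forall x y : L, x ≤ y -> y ≤ x -> x = y) /\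
  (forall S : L -> Prop, exists s, is_lub S s) /\
  (forall S : L -> Prop, exists s, is_glb S s).

Definition locally_complete (X : preorder) : Prop :=
  forall x : X, exists L : preorder,
    is_complete_lattice L /\
    equivalent_categories (preorder_category (down x)) (preorder_category L).

Record monotone (A B : preorder) := Monotone {
  monotone_fun :> A -> B;
  monotone_le : forall a a' : A, a ≤ a' -> monotone_fun a ≤ monotone_fun a'
}.

Lemma monotone_eq (A B : preorder) (f g : monotone A B) :
  (forall a, f a = g a) -> f = g.
Proof.
  destruct f as [f Hf], g as [g Hg]; simpl; intros H.
  apply functional_extensionality in H; subst g.
  f_equal; apply proof_irrelevance.
Qed.

Program Definition monotone_id (A : preorder) : monotone A A :=
  {| monotone_fun := fun a => a |}.

Program Definition monotone_comp (A B C : preorder) (g : monotone B C) (f : monotone A B) :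
    monotone A C :=
  {| monotone_fun := fun a => g (f a) |}.
Next Obligation. now do 2 apply monotone_le. Qed.

Record lax_obj (X : preorder) := LaxObj {
  lax_dom :> preorder;
  lax_map : monotone lax_dom X
}.

Record lax_hom (X : preorder) (A B : lax_obj X) := LaxHom {
  lax_fun :> monotone A B;
  lax_le : forall a : A, lax_map A a ≤ lax_map B (lax_fun a)
}.

Lemma lax_hom_eq (X : preorder) (A B : lax_obj X) (f g : lax_hom A B) :
  (forall a, f a = g a) -> f = g.
Proof.
  destruct f as [f Hf], g as [g Hg]; simpl; intros H.
  apply monotone_eq in H; subst g.
  f_equal; apply proof_irrelevance.
Qed.

Program Definition lax_comma (X : preorder) : category :=
  {| obj := lax_obj X;
     hom := @lax_hom X;
     ident := fun A => {| lax_fun := monotone_id A |};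
     comp := fun A B C g f => {| lax_fun := monotone_comp g f |} |}.
Next Obligation. reflexivity. Qed.
Next Obligation. transitivity (lax_map B (f a)); apply lax_le. Qed.
Next Obligation. now apply lax_hom_eq. Qed.
Next Obligation. now apply lax_hom_eq. Qed.
Next Obligation. now apply lax_hom_eq. Qed.

Lemma locally_complete_meet (X : preorder) (hX : locally_complete X) (x y z : X) :
  y ≤ x -> z ≤ x ->
  exists m : X, m ≤ y /\ m ≤ z /\ forall t, t ≤ y -> t ≤ z -> t ≤ m.
Proof.
  intros hy hz.
  destruct (hX x) as [L [[_ [_ glb]] [F [G [[t ht] _]]]]].
  set (y' := exist _ y hy : down x). set (z' := exist _ z hz : down x).
  destruct (glb (fun l => l = F y' \/ l = F z')) as [m [m_lb m_glb]].
  exists (proj1_sig (G m)). repeat split.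
  - transitivity (proj1_sig (G (F y'))).
    + exact (fmap G (m_lb (F y') (or_introl eq_refl))).
    + exact (t y').
  - transitivity (proj1_sig (G (F z'))).
    + exact (fmap G (m_lb (F z') (or_intror eq_refl))).
    + exact (t z').
  - intros w wy wz. set (w' := exist _ w (transitivity wy hy) : down x).
    transitivity (proj1_sig (G (F w'))).
    + destruct (ht w') as [g _]. exact g.
    + apply (fun h : hom (F w' : preorder_category L) m => fmap G h).
      apply m_glb. intros l [-> | ->].
      * exact (fmap F (wy : hom (w' : preorder_category (down x)) y')).
      * exact (fmap F (wz : hom (w' : preorder_category (down x)) z')).
Qed.

Lemma lax_comma_has_pullbacks (X : preorder) :
  locally_complete X -> has_pullbacks (lax_comma X).
Proof.
  intros hX; constructor; intros A B D f g.
  pose (car := {ab : A * B | f (fst ab) = g (snd ab)}).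
  assert (meet : forall ab : car, {m : X |
    m ≤ lax_map A (fst (proj1_sig ab)) /\ m ≤ lax_map B (snd (proj1_sig ab)) /\
    forall t, t ≤ lax_map A (fst (proj1_sig ab)) -> t ≤ lax_map B (snd (proj1_sig ab)) ->
      t ≤ m}).
  { intros [[a b] e]; simpl in *; apply constructive_indefinite_description.
    apply locally_complete_meet with (lax_map D (f a)); trivial.
    - apply lax_le.
    - rewrite e; apply lax_le. }
  pose (le_car := fun x y : car =>
    fst (proj1_sig x) ≤ fst (proj1_sig y) /\ snd (proj1_sig x) ≤ snd (proj1_sig y)).
  assert (le_car_pre : PreOrder le_car).
  { split.
    - intros x; split; reflexivity.
    - intros x y z [h1 h2] [h3 h4]; split; etransitivity; eassumption. }
  pose (P := {| le_preorder := le_car_pre |}).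
  assert (mono : forall x y : P, x ≤ y -> proj1_sig (meet x) ≤ proj1_sig (meet y)).
  { intros x y [h1 h2].
    destruct (proj2_sig (meet x)) as [m1 [m2 _]].
    apply (proj2 (proj2 (proj2_sig (meet y)))).
    - apply (transitivity m1); now apply monotone_le.
    - apply (transitivity m2); now apply monotone_le. }
  pose (PX := {| lax_dom := P; lax_map := Monotone mono |} : lax_comma X).
  assert (m1 : forall x y : P, x ≤ y -> fst (proj1_sig x) ≤ fst (proj1_sig y))
    by (intros x y [h _]; exact h).
  assert (m2 : forall x y : P, x ≤ y -> snd (proj1_sig x) ≤ snd (proj1_sig y))
    by (intros x y [_ h]; exact h).
  assert (l1 : forall x : PX, lax_map PX x ≤ lax_map A (Monotone m1 x))
    by (intros x; exact (proj1 (proj2_sig (meet x)))).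
  assert (l2 : forall x : PX, lax_map PX x ≤ lax_map B (Monotone m2 x))
    by (intros x; exact (proj1 (proj2 (proj2_sig (meet x))))).
  pose (p1 := LaxHom l1 : hom PX A). pose (p2 := LaxHom l2 : hom PX B).
  assert (lift : forall Z (u : hom Z A) (v : hom Z B), f ∘ u = g ∘ v ->
    {w : hom Z PX | p1 ∘ w = u /\ p2 ∘ w = v}).
  { intros Z u v e.
    assert (e' : forall z, f (u z) = g (v z))
      by (intros z; exact (f_equal (fun k : lax_hom Z D => k z) e)).
    pose (w := fun z => exist _ (u z, v z) (e' z) : P).
    assert (w_mono : forall z z', z ≤ z' -> w z ≤ w z')
      by (intros z z' h; split; simpl; now apply monotone_le).
    assert (w_lax : forall z : Z, lax_map Z z ≤ lax_map PX (Monotone w_mono z)).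
    { intros z; apply (proj2 (proj2 (proj2_sig (meet (w z))))).
      - exact (lax_le u z).
      - exact (lax_le v z). }
    exists (LaxHom w_lax). split; now apply lax_hom_eq. }
  refine {| pb_obj := PX; pb_fst := p1; pb_snd := p2;
            pb_lift := fun Z u v e => proj1_sig (lift Z u v e) |}.
  - apply lax_hom_eq; intros [[a b] e]; exact e.
  - intros Z u v e; apply (proj2_sig (lift Z u v e)).
  - intros Z u v e; apply (proj2_sig (lift Z u v e)).
  - intros Z w w' h1 h2; apply lax_hom_eq; intros z.
    assert (e1 : fst (proj1_sig (w z)) = fst (proj1_sig (w' z)))
      by exact (f_equal (fun k : lax_hom Z A => k z) h1).
    assert (e2 : snd (proj1_sig (w z)) = snd (proj1_sig (w' z)))
      by exact (f_equal (fun k : lax_hom Z B => k z) h2).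
    apply eq_sig_hprop; [intros; apply proof_irrelevance | now apply injective_projections].
Qed.

(* Main.v *)
(** Applying (b') with [x = β b] and [b1 = b0 = b] gives a section [s] of [p] on points
    with [β b ≤ ε (s b)]. Given an algebra [a] on [f : C -> E], each fibre of [p ∘ f]
    splits into orbits of the transport [c ↦ act e c], and the descended object consists
    of one representative of each orbit, the one lying over the image of [s]. Because
    [γ c ≤ β (p (f c)) ≤ ε (s (p (f c)))], this representative has the largest
    [X]-value of its orbit, so no suprema in [X] are needed. Condition (a) makes the
    order on orbits transitive, and (b') makes their [X]-values monotone. *)

Require Import Defs.
From Stdlib Require Import RelationClasses ProofIrrelevance ClassicalEpsilon.

Set Implicit Arguments.
Unset Strict Implicit.

(** * Criteria for equivalences, and for isomorphisms in slices and algebra categories *)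

Lemma equivalence_of_full_faithful_eso (C D : category) (F : functor C D) :
  (forall A B (h : hom (F A) (F B)), exists f, fmap F f = h) ->
  (forall A B (f g : hom A B), fmap F f = fmap F g -> f = g) ->
  (forall Y : D, exists (A : C) (i : hom (F A) Y), is_iso i) ->
  is_equivalence F.
Proof.
  intros full faithful eso.
  assert (lift : forall A B (h : hom (F A) (F B)), {f | fmap F f = h})
    by (intros; now apply constructive_indefinite_description).
  assert (pre : forall Y : D, {A : C & {i : hom (F A) Y & {j : hom Y (F A) |
    j ∘ i = ident (F A) /\ i ∘ j = ident Y}}}).
  { intros Y.
    destruct (constructive_indefinite_description _ (eso Y)) as [A HA].
    destruct (constructive_indefinite_description _ HA) as [i Hi].
    exists A, i. now apply constructive_indefinite_description. }
  pose (G0 := fun Y => projT1 (pre Y)).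
  pose (i := fun Y => projT1 (projT2 (pre Y)) : hom (F (G0 Y)) Y).
  pose (j := fun Y => proj1_sig (projT2 (projT2 (pre Y))) : hom Y (F (G0 Y))).
  assert (ji : forall Y, j Y ∘ i Y = ident (F (G0 Y)))
    by (intros Y; exact (proj1 (proj2_sig (projT2 (projT2 (pre Y)))))).
  assert (ij : forall Y, i Y ∘ j Y = ident Y)
    by (intros Y; exact (proj2 (proj2_sig (projT2 (projT2 (pre Y)))))).
  clearbody i j.
  (* On morphisms the inverse lifts the conjugate of [h] by the chosen isomorphisms [i] and [j]; its
     functor laws are checked after applying [F], by faithfulness. *)
  pose (G1 := fun Y Z (h : hom Y Z) => proj1_sig (lift _ _ (j Z ∘ h ∘ i Y))).
  assert (FG1 : forall Y Z (h : hom Y Z), fmap F (G1 Y Z h) = j Z ∘ h ∘ i Y)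
    by (intros Y Z h; exact (proj2_sig (lift _ _ (j Z ∘ h ∘ i Y)))).
  clearbody G1.
  assert (G1_id : forall Y, G1 Y Y (ident Y) = ident (G0 Y))
    by (intros Y; apply faithful; now rewrite FG1, comp_id_r, fmap_id).
  assert (G1_comp : forall Y Z W (g : hom Z W) (f : hom Y Z),
    G1 Y W (g ∘ f) = G1 Z W g ∘ G1 Y Z f).
  { intros Y Z W g f. apply faithful.
    now rewrite fmap_comp, !FG1, !comp_assoc, <- (comp_assoc _ (i Z)), ij, comp_id_r. }
  pose (G := {| fobj := G0; fmap := G1; fmap_id := G1_id; fmap_comp := G1_comp |}).
  pose (t := fun A => proj1_sig (lift (G (F A)) A (i (F A)))).
  assert (Ft : forall A, fmap F (t A) = i (F A))
    by (intros A; exact (proj2_sig (lift (G (F A)) A (i (F A))))).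
  assert (t_nat : forall A A' (f : hom A A'), t A' ∘ fmap G (fmap F f) = f ∘ t A).
  { intros A A' f. apply faithful. rewrite !fmap_comp, !Ft. simpl.
    now rewrite FG1, !comp_assoc, ij, comp_id_l. }
  assert (i_nat : forall Y Z (h : hom Y Z), i Z ∘ fmap F (fmap G h) = h ∘ i Y)
    by (intros Y Z h; simpl; now rewrite FG1, !comp_assoc, ij, comp_id_l).
  exists G. split.
  - exists (@NatTrans _ _ (comp_functor G F) (id_functor C) t t_nat).
    intros A. destruct (lift A (G (F A)) (j (F A))) as [r Fr].
    assert (rt : r ∘ t A = ident (G (F A)))
      by (apply faithful; rewrite fmap_comp, fmap_id, Ft, Fr; apply ji).
    assert (tr : t A ∘ r = ident A)
      by (apply faithful; rewrite fmap_comp, fmap_id, Ft, Fr; apply ij).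
    exists r. exact (conj rt tr).
  - exists (@NatTrans _ _ (comp_functor F G) (id_functor D) i i_nat).
    intros Y. exists (j Y). exact (conj (ji Y) (ij Y)).
Qed.

Lemma slice_iso (C : category) (B : C) (Y Z : slice B) (f : hom Y Z) :
  is_iso (slice_mor f) -> is_iso f.
Proof.
  intros [g [gf fg]].
  assert (Hg : slice_map Y ∘ g = slice_map Z)
    by now rewrite <- (slice_comm f), <- comp_assoc, fg, comp_id_r.
  exists {| slice_mor := g; slice_comm := Hg |}.
  split; now apply slice_hom_eq.
Qed.

(** Composing [alg_hom_action f] with [g] on the left and [fmap T g] on the right turns it into the
    equation for [g]. *)
Lemma algebra_iso (C : category) (T : monad C) (Y Z : algebra_category T) (f : hom Y Z) :
  is_iso (alg_hom f) -> is_iso f.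
Proof.
  intros [g [gf fg]].
  assert (Hg : g ∘ alg_action Z = alg_action Y ∘ fmap T g).
  { rewrite <- (comp_id_r (g ∘ alg_action Z)), <- fmap_id, <- fg, fmap_comp.
    rewrite !comp_assoc, <- (comp_assoc g), <- (alg_hom_action f), comp_assoc.
    now rewrite gf, comp_id_l. }
  exists {| alg_hom := g; alg_hom_action := Hg |}.
  split; now apply algebra_hom_eq.
Qed.

(** * Evaluation of lax morphisms and constant probing objects *)

Lemma lax_hom_app (X : preorder) (Y Z : lax_comma X) (f g : hom Y Z) (e : f = g) (y : Y) :
  lax_fun f y = lax_fun g y.
Proof. now rewrite e. Qed.

(* Maps out of the chains with constant value [x] probe the points, the order and the
   [X]-values of an arbitrary pullback. *)
Program Definition chain1 : preorder :=
  {| carrier := Datatypes.unit; le := fun _ _ => True |}.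
Next Obligation. now split. Qed.

Program Definition chain2 : preorder :=
  {| carrier := bool; le := fun i j => i = true -> j = true |}.
Next Obligation. split; red; auto. Qed.

Program Definition const_obj (X : preorder) (A : preorder) (x : X) : lax_comma X :=
  {| lax_dom := A; lax_map := {| monotone_fun := fun _ => x |} |}.
Next Obligation. reflexivity. Qed.

Program Definition const_point (X : preorder) (A : lax_comma X) (x : X) (a : A)
    (ha : x ≤ lax_map A a) : hom (const_obj chain1 x) A :=
  {| lax_fun := {| monotone_fun := fun _ => a |} |}.
Next Obligation. reflexivity. Qed.

Program Definition const_arrow (X : preorder) (A : lax_comma X) (x : X) (a a' : A)
    (ha : x ≤ lax_map A a) (haa : a ≤ a') : hom (const_obj chain2 x) A :=
  {| lax_fun := {| monotone_fun := fun i : bool => if i then a' else a |} |}.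
Next Obligation.
  destruct a0, a'0; try reflexivity; trivial. now discriminate (H eq_refl).
Qed.
Next Obligation.
  destruct a0; trivial. transitivity (lax_map A a); trivial. now apply monotone_le.
Qed.

(** * Points, order and values of an arbitrary pullback *)

Section Pullback.

Context (X : preorder) (hX : locally_complete X) (A B D : lax_comma X)
  (f : hom A D) (g : hom B D) (P : pullback f g).

Lemma pb_point (a : A) (b : B) (x : X) :
  lax_fun f a = lax_fun g b -> x ≤ lax_map A a -> x ≤ lax_map B b ->
  exists z : pb_obj P, lax_fun (pb_fst P) z = a /\ lax_fun (pb_snd P) z = b /\
    x ≤ lax_map (pb_obj P) z.
Proof.
  intros e xa xb.
  assert (H : f ∘ const_point xa = g ∘ const_point xb) by now apply lax_hom_eq.
  exists (lax_fun (pb_lift P H) tt). repeat split.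
  - exact (lax_hom_app (pb_lift_fst P H) tt).
  - exact (lax_hom_app (pb_lift_snd P H) tt).
  - exact (lax_le (pb_lift P H) tt).
Qed.

(** Both points are images of the one-point object with value [lax_map (pb_obj P) z]; the inequality
    is what makes the map onto [z'] lax, and [pb_unique] identifies the two maps. *)
Lemma pb_point_eq_le (z z' : pb_obj P) :
  lax_fun (pb_fst P) z = lax_fun (pb_fst P) z' ->
  lax_fun (pb_snd P) z = lax_fun (pb_snd P) z' ->
  lax_map (pb_obj P) z ≤ lax_map (pb_obj P) z' -> z = z'.
Proof.
  intros e1 e2 h.
  refine (lax_hom_app (pb_unique (w := const_point (reflexivity _)) (w' := const_point h) _ _) tt);
    now apply lax_hom_eq.
Qed.

(** Both values lie below the value of the common image in [D], so local completeness provides their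
    meet, and [pb_point] yields a point whose value is at least that meet. *)
Lemma pb_meet_point (a : A) (b : B) :
  lax_fun f a = lax_fun g b ->
  exists z : pb_obj P, lax_fun (pb_fst P) z = a /\ lax_fun (pb_snd P) z = b /\
    forall x, x ≤ lax_map A a -> x ≤ lax_map B b -> x ≤ lax_map (pb_obj P) z.
Proof.
  intros e.
  destruct (@locally_complete_meet X hX (lax_map D (lax_fun f a))
    (lax_map A a) (lax_map B b)) as [m [ma [mb mm]]].
  - apply lax_le.
  - rewrite e. apply lax_le.
  - destruct (pb_point e ma mb) as [z [za [zb zm]]]. exists z. repeat split; trivial.
    intros x xa xb. transitivity m; auto.
Qed.

(** The values of [z] and [z'] are not known to be comparable, but both lie below that of the meet
    point [w] over the same pair, so each point equals [w]. *)
Lemma pb_point_eq (z z' : pb_obj P) :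
  lax_fun (pb_fst P) z = lax_fun (pb_fst P) z' ->
  lax_fun (pb_snd P) z = lax_fun (pb_snd P) z' -> z = z'.
Proof.
  intros e1 e2.
  destruct (pb_meet_point (lax_hom_app (pb_comm P) z)) as [w [wa [wb wm]]].
  assert (H : forall y : pb_obj P, lax_fun (pb_fst P) y = lax_fun (pb_fst P) z ->
    lax_fun (pb_snd P) y = lax_fun (pb_snd P) z -> y = w).
  { intros y y1 y2. apply pb_point_eq_le; try congruence.
    apply wm; [rewrite <- y1 | rewrite <- y2]; apply lax_le. }
  transitivity w; [| symmetry]; auto.
Qed.

(** By uniqueness [z] is the meet point over its own projections; only its occurrence in the
    conclusion is rewritten to [w]. *)
Lemma pb_le_map (z : pb_obj P) (x : X) :
  x ≤ lax_map A (lax_fun (pb_fst P) z) -> x ≤ lax_map B (lax_fun (pb_snd P) z) ->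
  x ≤ lax_map (pb_obj P) z.
Proof.
  destruct (pb_meet_point (lax_hom_app (pb_comm P) z)) as [w [wa [wb wm]]].
  rewrite (pb_point_eq (eq_sym wa) (eq_sym wb)) at 3. auto.
Qed.

(** The two inequalities are maps out of the two-element chain with the value of [z]; the ends of
    their lift are [z] and [z'] by [pb_point_eq]. *)
Lemma pb_le (z z' : pb_obj P) :
  lax_fun (pb_fst P) z ≤ lax_fun (pb_fst P) z' ->
  lax_fun (pb_snd P) z ≤ lax_fun (pb_snd P) z' -> z ≤ z'.
Proof.
  intros h1 h2.
  pose (u := const_arrow (lax_le (pb_fst P) z) h1).
  pose (v := const_arrow (lax_le (pb_snd P) z) h2).
  assert (H : f ∘ u = g ∘ v).
  { apply lax_hom_eq. intros []; exact (lax_hom_app (pb_comm P) _). }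
  set (w := pb_lift P H).
  assert (w1 : forall i, lax_fun (pb_fst P) (lax_fun w i) = lax_fun u i)
    by (intros i; exact (lax_hom_app (pb_lift_fst P H) i)).
  assert (w2 : forall i, lax_fun (pb_snd P) (lax_fun w i) = lax_fun v i)
    by (intros i; exact (lax_hom_app (pb_lift_snd P H) i)).
  rewrite <- (pb_point_eq (w1 false) (w2 false)), <- (pb_point_eq (w1 true) (w2 true)).
  apply monotone_le. now intros.
Qed.

End Pullback.

(** * Transport along an algebra structure *)

Section Descent.

Context (X : preorder) (hX : locally_complete X) (E B : lax_comma X) (p : hom E B).

Context (C : lax_comma X) (f : hom C E) (P : pullback p (p ∘ f)) (a : hom (pb_obj P) C).

(** The algebra laws read at points. With points of the pullback written as pairs, [a_assoc]
    concerns [w = (e', c)], [z = (e, a w)] and [v = (e, c)]: transport to [e'] and then to [e]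
    agrees with direct transport to [e]. *)
Context (a_over : forall z, lax_fun f (lax_fun a z) = lax_fun (pb_fst P) z)
  (a_unit : forall z, lax_fun (pb_fst P) z = lax_fun f (lax_fun (pb_snd P) z) ->
    lax_fun a z = lax_fun (pb_snd P) z)
  (a_assoc : forall z w v, lax_fun (pb_snd P) z = lax_fun a w ->
    lax_fun (pb_fst P) v = lax_fun (pb_fst P) z ->
    lax_fun (pb_snd P) v = lax_fun (pb_snd P) w -> lax_fun a z = lax_fun a v).

(* Total in [e] and [c], with junk value [c] off the pullback, to avoid carrying
   the proof of [p e = p (f c)] in terms. *)
Definition act (e : E) (c : C) : C :=
  match excluded_middle_informative (lax_fun p e = lax_fun (p ∘ f) c) with
  | left H =>
      lax_fun a (proj1_sig (constructive_indefinite_description _ (pb_meet_point hX P H)))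
  | right _ => c
  end.

Lemma act_point (e : E) (c : C) :
  lax_fun p e = lax_fun p (lax_fun f c) ->
  exists z, lax_fun (pb_fst P) z = e /\ lax_fun (pb_snd P) z = c /\ act e c = lax_fun a z.
Proof.
  intros H. unfold act.
  destruct (excluded_middle_informative _) as [H' | H']; [| contradiction].
  destruct (constructive_indefinite_description _ _) as [z [z1 [z2 z3]]]; simpl.
  now exists z.
Qed.

(** The point over a given pair is unique, so the choice made inside [act] is harmless. *)
Lemma actE (z : pb_obj P) :
  act (lax_fun (pb_fst P) z) (lax_fun (pb_snd P) z) = lax_fun a z.
Proof.
  destruct (act_point (lax_hom_app (pb_comm P) z)) as [w [w1 [w2 ->]]].
  f_equal. now apply (pb_point_eq hX).
Qed.

Lemma act_over (e : E) (c : C) :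
  lax_fun p e = lax_fun p (lax_fun f c) -> lax_fun f (act e c) = e.
Proof.
  intros H. destruct (act_point H) as [z [z1 [z2 ->]]]. now rewrite a_over.
Qed.

Lemma act_unit (c : C) : act (lax_fun f c) c = c.
Proof.
  destruct (@act_point (lax_fun f c) c eq_refl) as [z [z1 [z2 ->]]].
  rewrite a_unit; congruence.
Qed.

Lemma act_assoc (e e' : E) (c : C) :
  lax_fun p e = lax_fun p (lax_fun f c) -> lax_fun p e' = lax_fun p (lax_fun f c) ->
  act e (act e' c) = act e c.
Proof.
  intros H H'.
  assert (H2 : lax_fun p e = lax_fun p (lax_fun f (act e' c)))
    by now rewrite act_over, H'.
  destruct (act_point H) as [v [v1 [v2 ->]]].
  destruct (act_point H2) as [z [z1 [z2 ->]]].
  destruct (act_point H') as [w [w1 [w2 Hw]]].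
  apply a_assoc with w; congruence.
Qed.

Lemma act_mono (e e' : E) (c c' : C) :
  lax_fun p e = lax_fun p (lax_fun f c) -> lax_fun p e' = lax_fun p (lax_fun f c') ->
  e ≤ e' -> c ≤ c' -> act e c ≤ act e' c'.
Proof.
  intros H H' he hc.
  destruct (act_point H) as [z [z1 [z2 ->]]].
  destruct (act_point H') as [w [w1 [w2 ->]]].
  apply monotone_le, (pb_le hX); congruence.
Qed.

Lemma act_le_map (e : E) (c : C) (x : X) :
  lax_fun p e = lax_fun p (lax_fun f c) -> x ≤ lax_map E e -> x ≤ lax_map C c ->
  x ≤ lax_map C (act e c).
Proof.
  intros H xe xc. destruct (act_point H) as [z [<- [<- ->]]].
  transitivity (lax_map (pb_obj P) z); [now apply (pb_le_map hX) | apply (lax_le a)].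
Qed.

(** * The order on orbits and the descended object *)

Context (ha : forall b2 b1 b0 : lax_dom B, b2 ≤ b1 -> b1 ≤ b0 ->
    exists e2 e1 e0 : lax_dom E, e2 ≤ e1 /\ e1 ≤ e0 /\
      lax_fun p e2 = b2 /\ lax_fun p e1 = b1 /\ lax_fun p e0 = b0)
  (hb : forall (x : X) (b1 b0 : lax_dom B),
    b1 ≤ b0 -> x ≤ lax_map B b1 ->
    exists e1 e0 : lax_dom E, e1 ≤ e0 /\ x ≤ lax_map E e1 /\
      lax_fun p e1 = b1 /\ lax_fun p e0 = b0)
  (s : B -> E) (ps : forall b, lax_fun p (s b) = b)
  (le_s : forall b, lax_map B b ≤ lax_map E (s b)).

Lemma le_act_section (c : C) :
  lax_map C c ≤ lax_map C (act (s (lax_fun p (lax_fun f c))) c).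
Proof.
  apply act_le_map; try reflexivity; [apply ps |].
  transitivity (lax_map B (lax_fun (p ∘ f) c)); [apply lax_le | apply le_s].
Qed.

Definition representative (c : C) : Prop := lax_fun f c = s (lax_fun p (lax_fun f c)).

Lemma act_section_representative (c : C) :
  representative (act (s (lax_fun p (lax_fun f c))) c).
Proof. unfold representative. now rewrite act_over, ps. Qed.

(** The relation compares orbits through arbitrary members. It is universal in [e ≤ e'] for ease of
    use: if it holds for one such pair over the two images, [act_mono] and [act_assoc] carry it to
    all of them. *)
Definition descent_le (c c' : C) : Prop :=
  lax_fun p (lax_fun f c) ≤ lax_fun p (lax_fun f c') /\
  forall e e' : E, e ≤ e' -> lax_fun p e = lax_fun p (lax_fun f c) ->
    lax_fun p e' = lax_fun p (lax_fun f c') -> act e c ≤ act e' c'.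

Lemma descent_le_of_le (c c' : C) : c ≤ c' -> descent_le c c'.
Proof.
  intros h. split; [now do 2 apply monotone_le |].
  intros e e' he H H'. now apply act_mono.
Qed.

Lemma descent_le_trans (c2 c1 c0 : C) :
  descent_le c2 c1 -> descent_le c1 c0 -> descent_le c2 c0.
Proof.
  intros [b21 h21] [b10 h10]. split; [etransitivity; eassumption |].
  intros e e' he H H'.
  (* Nothing over the middle point need lie between [e] and [e']. So the comparison is made along a
     lifted chain and then transported to [e] and [e']. *)
  destruct (ha b21 b10) as [e2 [e1 [e0 [e21 [e10 [p2 [p1 p0]]]]]]].
  rewrite <- (act_assoc H p2), <- (act_assoc H' p0).
  apply act_mono; trivial; try (now rewrite act_over; congruence).
  transitivity (act e1 c1); auto.
Qed.

Lemma descent_le_act (e : E) (c : C) :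
  lax_fun p e = lax_fun p (lax_fun f c) ->
  descent_le c (act e c) /\ descent_le (act e c) c.
Proof.
  intros H.
  split; split; rewrite ?act_over, ?H; trivial; try reflexivity;
    intros e1 e2 he H1 H2; rewrite act_assoc; trivial; apply act_mono; trivial;
    reflexivity.
Qed.

Lemma descent_le_map (c c' : C) :
  representative c' -> descent_le c c' -> lax_map C c ≤ lax_map C c'.
Proof.
  intros rc [hb' h].
  (* Condition (b') is taken at the value of the image of [c] in [B], so transport to [e1] does not
     lower the value of [c]. At the other end, [c'] is the transport of [act e0 c'] to the section,
     which does not lower values either. *)
  destruct (hb hb' (reflexivity _)) as [e1 [e0 [he [xe [p1 p0]]]]].
  transitivity (lax_map C (act e1 c)).
  - apply act_le_map; try reflexivity; trivial.
    transitivity (lax_map B (lax_fun (p ∘ f) c)); [apply lax_le | exact xe].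
  - transitivity (lax_map C (act e0 c')); [now apply monotone_le, h |].
    transitivity (lax_map C (act (s (lax_fun p (lax_fun f (act e0 c')))) (act e0 c')));
      [apply le_act_section |].
    rewrite act_over by trivial. rewrite p0, <- rc.
    rewrite act_assoc by trivial. rewrite act_unit. reflexivity.
Qed.

Program Definition descent_preorder : preorder :=
  {| carrier := {c : C | representative c};
     le := fun d d' => descent_le (proj1_sig d) (proj1_sig d') |}.
Next Obligation.
  split.
  - intros d. apply descent_le_of_le. reflexivity.
  - intros d d' d''. apply descent_le_trans.
Qed.

Program Definition descent_lax : lax_comma X :=
  {| lax_dom := descent_preorder;
     lax_map := {| monotone_fun := fun d => lax_map C (proj1_sig d) |} |}.
Next Obligation. now apply descent_le_map. Qed.

Program Definition descent_map : hom descent_lax B :=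
  {| lax_fun := {| monotone_fun := fun d => lax_fun p (lax_fun f (proj1_sig d)) |} |}.
Next Obligation. apply H. Qed.
Next Obligation. exact (lax_le (p ∘ f) _). Qed.

(** * Pulling the descended object back recovers the algebra *)

Context (Q : pullback p descent_map).

Lemma descent_pullback_comm (z : pb_obj Q) :
  lax_fun p (lax_fun (pb_fst Q) z) =
  lax_fun p (lax_fun f (proj1_sig (lax_fun (pb_snd Q) z))).
Proof. exact (lax_hom_app (pb_comm Q) z). Qed.

(** This transport of representatives is the intended isomorphism from the pullback onto [C]. *)
Program Definition descent_counit : hom (pb_obj Q) C :=
  {| lax_fun := {| monotone_fun := fun z =>
       act (lax_fun (pb_fst Q) z) (proj1_sig (lax_fun (pb_snd Q) z)) |} |}.
Next Obligation.
  apply (monotone_le (lax_fun (pb_snd Q)) H); [now apply monotone_le | |];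
    apply descent_pullback_comm.
Qed.
Next Obligation.
  apply act_le_map.
  - apply descent_pullback_comm.
  - apply lax_le.
  - exact (lax_le (pb_snd Q) _).
Qed.

Program Definition descent_quotient : hom C descent_lax :=
  {| lax_fun := {| monotone_fun := fun c =>
       exist _ _ (act_section_representative c) : descent_lax |} |}.
Next Obligation.
  unfold descent_preorder; simpl.
  (* Each point is equivalent to its representative, so the comparison passes through [a0 ≤ a']. *)
  apply descent_le_trans with a0; [now apply descent_le_act, ps |].
  apply descent_le_trans with a'; [now apply descent_le_of_le |].
  now apply descent_le_act, ps.
Qed.
Next Obligation. apply le_act_section. Qed.

Lemma descent_quotient_comm : p ∘ f = descent_map ∘ descent_quotient.
Proof.
  apply lax_hom_eq. intros c. simpl. now rewrite act_over, ps.
Qed.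

Lemma descent_counit_over : f ∘ descent_counit = pb_fst Q.
Proof.
  apply lax_hom_eq. intros z. simpl. apply act_over, descent_pullback_comm.
Qed.

(** The inverse sends [c] to the pair of [f c] and the representative of its orbit. Transporting
    that representative back to [f c] returns [c]; conversely, a representative moved to any [e] of
    its fibre is again selected as the representative. *)
Lemma descent_counit_iso : is_iso descent_counit.
Proof.
  exists (pb_lift Q descent_quotient_comm). split.
  - assert (e1 := pb_lift_fst Q descent_quotient_comm).
    assert (e2 := pb_lift_snd Q descent_quotient_comm).
    apply pb_unique; rewrite comp_assoc, comp_id_r.
    + rewrite e1. apply descent_counit_over.
    + rewrite e2. apply lax_hom_eq. intros z.
      apply eq_sig_hprop; [intros; apply proof_irrelevance |]. simpl.
      assert (H := descent_pullback_comm z).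
      rewrite act_over by trivial. rewrite H, act_assoc by (trivial; apply ps).
      rewrite <- (proj2_sig (lax_fun (pb_snd Q) z)). apply act_unit.
  - apply lax_hom_eq. intros c. simpl.
    assert (e1 := lax_hom_app (pb_lift_fst Q descent_quotient_comm) c).
    assert (e2 := lax_hom_app (pb_lift_snd Q descent_quotient_comm) c).
    simpl in e1, e2. rewrite e1, e2. simpl.
    rewrite act_assoc by (trivial; apply ps). apply act_unit.
Qed.

End Descent.

(** * The comparison functor: essential surjectivity, faithfulness and fullness *)

Section Comparison.

Context (X : preorder) (hX : locally_complete X) (E B : lax_comma X) (p : hom E B)
  (pb : chosen_pullbacks (lax_comma X)).

Lemma comparison_eso
    (ha : forall b2 b1 b0 : lax_dom B, b2 ≤ b1 -> b1 ≤ b0 ->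
      exists e2 e1 e0 : lax_dom E, e2 ≤ e1 /\ e1 ≤ e0 /\
        lax_fun p e2 = b2 /\ lax_fun p e1 = b1 /\ lax_fun p e0 = b0)
    (hb : forall (x : X) (b1 b0 : lax_dom B),
      b1 ≤ b0 -> x ≤ lax_map B b1 ->
      exists e1 e0 : lax_dom E, e1 ≤ e0 /\ x ≤ lax_map E e1 /\
        lax_fun p e1 = b1 /\ lax_fun p e0 = b0)
    (s : B -> E) (ps : forall b, lax_fun p (s b) = b)
    (le_s : forall b, lax_map B b ≤ lax_map E (s b))
    (A : algebra (adjunction_monad (pullback_adjunction pb p))) :
  exists (Y : slice B) (i : hom (comparison_functor (pullback_adjunction pb p) Y) A),
    is_iso i.
Proof.
  pose (C := slice_dom (alg_carrier A)).
  pose (f := slice_map (alg_carrier A) : hom C E).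
  pose (P := pb p (p ∘ f)).
  pose (a := slice_mor (alg_action A) : hom (pb_obj P) C).
  assert (mor_unit := f_equal (@slice_mor _ _ _ _) (alg_unit A)).
  assert (mor_assoc := f_equal (@slice_mor _ _ _ _) (alg_assoc A)).
  assert (a_over : forall z, lax_fun f (lax_fun a z) = lax_fun (pb_fst P) z)
    by (intros z; exact (lax_hom_app (slice_comm (alg_action A)) z)).
  assert (a_unit : forall z, lax_fun (pb_fst P) z = lax_fun f (lax_fun (pb_snd P) z) ->
    lax_fun a z = lax_fun (pb_snd P) z).
  { intros z Hz. etransitivity; [| exact (lax_hom_app mor_unit (lax_fun (pb_snd P) z))].
    refine (f_equal (lax_fun a) _). apply (pb_point_eq hX).
    - rewrite Hz. symmetry.
      exact (lax_hom_app (pb_lift_fst P _) (lax_fun (pb_snd P) z)).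
    - symmetry. exact (lax_hom_app (pb_lift_snd P _) (lax_fun (pb_snd P) z)). }
  assert (a_assoc : forall z w v, lax_fun (pb_snd P) z = lax_fun a w ->
    lax_fun (pb_fst P) v = lax_fun (pb_fst P) z ->
    lax_fun (pb_snd P) v = lax_fun (pb_snd P) w -> lax_fun a z = lax_fun a v).
  { intros z w v zw v1 v2.
    (* The associativity law is evaluated at the point [y = (e, w)] of the iterated pullback, with
       [e] the first projection of [z]: the functor applied to the action sends [y] to [z], and the
       multiplication sends it to [v]. *)
    pose (PP := pb p (p ∘ pb_fst P)).
    destruct (@pb_meet_point _ hX _ _ _ _ _ PP (lax_fun (pb_fst P) z) w)
      as [y [y1 [y2 _]]].
    { etransitivity; [exact (lax_hom_app (pb_comm P) z) |].
      change (lax_fun p (lax_fun f (lax_fun (pb_snd P) z)) =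
        lax_fun p (lax_fun (pb_fst P) w)).
      now rewrite zw, a_over. }
    assert (H := lax_hom_app mor_assoc y).
    etransitivity; [etransitivity; [| symmetry; exact H] |];
      refine (f_equal (lax_fun a) _); apply (pb_point_eq hX).
    - symmetry. etransitivity; [exact (lax_hom_app (pb_lift_fst P _) y) | exact y1].
    - symmetry. etransitivity; [exact (lax_hom_app (pb_lift_snd P _) y) |].
      now rewrite zw, <- y2.
    - etransitivity; [exact (lax_hom_app (pb_lift_fst P _) y) |].
      exact (eq_trans y1 (eq_sym v1)).
    - etransitivity; [exact (lax_hom_app (pb_lift_snd P _) y) |].
      exact (eq_trans (f_equal (lax_fun (pb_snd P)) y2) (eq_sym v2)). }
  pose (D := @SliceObj (lax_comma X) B _
    (descent_map hX a_over a_unit a_assoc ha hb ps le_s)).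
  pose (Q := pb p (slice_map D)).
  pose (K := comparison_functor (pullback_adjunction pb p) D).
  pose (i := @SliceHom _ _ (alg_carrier K) (alg_carrier A) _ (descent_counit_over Q)
    : hom (alg_carrier K) (alg_carrier A)).
  assert (i_action : i ∘ alg_action K =
    alg_action A ∘ fmap (adjunction_monad (pullback_adjunction pb p)) i).
  { apply slice_hom_eq, lax_hom_eq. intros z.
    (* At [z = (e, (e', r))] the two sides are [act e r] and [act e (act e' r)], which [act_assoc]
       identifies; [u] is [(e, r)] and [v] is [(e, act e' r)]. *)
    pose (R := pb p (p ∘ pb_fst Q)).
    assert (Hz := lax_hom_app (pb_comm R) z).
    pose (d := lax_fun (pb_snd R) z).
    pose (u := lax_fun (slice_mor (alg_action K)) z).
    pose (v := lax_fun (slice_mor (fmap (adjunction_monad (pullback_adjunction pb p)) i)) z).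
    assert (u1 : lax_fun (pb_fst Q) u = lax_fun (pb_fst R) z)
      by exact (lax_hom_app (pb_lift_fst Q _) z).
    assert (u2 : lax_fun (pb_snd Q) u = lax_fun (pb_snd Q) d)
      by exact (lax_hom_app (pb_lift_snd Q _) z).
    assert (v1 : lax_fun (pb_fst P) v = lax_fun (pb_fst R) z)
      by exact (lax_hom_app (pb_lift_fst P _) z).
    assert (v2 : lax_fun (pb_snd P) v =
        act hX a (lax_fun (pb_fst Q) d) (proj1_sig (lax_fun (pb_snd Q) d)))
      by exact (lax_hom_app (pb_lift_snd P _) z).
    change (act hX a (lax_fun (pb_fst Q) u) (proj1_sig (lax_fun (pb_snd Q) u)) =
      lax_fun a v).
    rewrite <- (actE hX a), v1, v2, u1, u2. symmetry.
    assert (Hd := descent_pullback_comm d).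
    apply act_assoc; [assumption .. | exact (eq_trans Hz Hd) | exact Hd]. }
  exists D, (AlgebraHom i_action : hom K A).
  apply algebra_iso, slice_iso, descent_counit_iso.
Qed.

(** Surjectivity of [p] makes every [y] the second projection of a point of the pullback, and there
    naturality of the counit recovers the morphism. *)
Lemma comparison_faithful (surj : forall b : B, exists e : E, lax_fun p e = b)
    (Y Z : slice B) (f g : hom Y Z) :
  fmap (comparison_functor (pullback_adjunction pb p)) f =
  fmap (comparison_functor (pullback_adjunction pb p)) g -> f = g.
Proof.
  intros H. apply slice_hom_eq, lax_hom_eq. intros y.
  destruct (surj (lax_fun (slice_map Y) y)) as [e He].
  destruct (pb_meet_point hX (pb p (slice_map Y)) He) as [z [_ [<- _]]].
  assert (H' := f_equal (@slice_mor _ _ _ _) (f_equal (@alg_hom _ _ _ _) H)).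
  assert (Hz := f_equal (lax_fun (pb_snd (pb p (slice_map Z)))) (lax_hom_app H' z)).
  assert (counit_nat : forall k : hom Y Z,
    lax_fun (pb_snd (pb p (slice_map Z))) (lax_fun (slice_mor (alg_hom
      (fmap (comparison_functor (pullback_adjunction pb p)) k))) z) =
    lax_fun (slice_mor k) (lax_fun (pb_snd (pb p (slice_map Y))) z)).
  { intros k.
    assert (Hk := pb_lift_snd (pb p (slice_map Z)) (pullback_functor_comm pb p k)).
    exact (lax_hom_app Hk z). }
  exact (eq_trans (eq_sym (counit_nat f)) (eq_trans Hz (counit_nat g))).
Qed.

(** The second component of an algebra morphism at [(e, y)] does not depend on [e], so it descends
    to a function of [y]. Evaluating at the section controls its values; lifting inequalities along
    [p] gives monotonicity. *)
Lemma comparison_full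
    (ordered : forall b1 b0 : B, b1 ≤ b0 ->
      exists e1 e0 : E, e1 ≤ e0 /\ lax_fun p e1 = b1 /\ lax_fun p e0 = b0)
    (s : B -> E) (ps : forall b, lax_fun p (s b) = b)
    (le_s : forall b, lax_map B b ≤ lax_map E (s b))
    (Y Z : slice B)
    (h : hom (comparison_functor (pullback_adjunction pb p) Y)
             (comparison_functor (pullback_adjunction pb p) Z)) :
  exists f : hom Y Z, fmap (comparison_functor (pullback_adjunction pb p)) f = h.
Proof.
  pose (P := pb p (slice_map Y)). pose (Q := pb p (slice_map Z)).
  pose (k := slice_mor (alg_hom h) : hom (pb_obj P) (pb_obj Q)).
  assert (k_over : forall z, lax_fun (pb_fst Q) (lax_fun k z) = lax_fun (pb_fst P) z)
    by (intros z; exact (lax_hom_app (slice_comm (alg_hom h)) z)).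
  assert (k_snd : forall z z', lax_fun (pb_snd P) z = lax_fun (pb_snd P) z' ->
    lax_fun (pb_snd Q) (lax_fun k z) = lax_fun (pb_snd Q) (lax_fun k z')).
  { intros z z' e.
    (* The action on the pullback of [Y] replaces the first component, so it sends the pair of
       [fst z] and [z'] to [z]; compatibility of [h] with the actions then compares [k z] with
       [k z']. *)
    pose (R := pb p (p ∘ pb_fst P)).
    destruct (@pb_meet_point _ hX _ _ _ _ _ R (lax_fun (pb_fst P) z) z')
      as [y [y1 [y2 _]]].
    { etransitivity; [exact (lax_hom_app (pb_comm P) z) |].
      exact (eq_trans (f_equal (lax_fun (slice_map Y)) e)
        (eq_sym (lax_hom_app (pb_comm P) z'))). }
    assert (H := f_equal (lax_fun (pb_snd Q))
      (lax_hom_app (f_equal (@slice_mor _ _ _ _) (alg_hom_action h)) y)).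
    pose (u := lax_fun (slice_mor (alg_action
      (comparison_functor (pullback_adjunction pb p) Y))) y).
    assert (u1 : lax_fun (pb_fst P) u = lax_fun (pb_fst R) y)
      by exact (lax_hom_app (pb_lift_fst P _) y).
    assert (u2 : lax_fun (pb_snd P) u = lax_fun (pb_snd P) (lax_fun (pb_snd R) y))
      by exact (lax_hom_app (pb_lift_snd P _) y).
    assert (uz : u = z).
    { apply (pb_point_eq hX); [exact (eq_trans u1 y1) |].
      exact (eq_trans u2 (eq_trans (f_equal (lax_fun (pb_snd P)) y2) (eq_sym e))). }
    rewrite <- uz, <- y2.
    etransitivity; [exact H |].
    etransitivity; [exact (lax_hom_app (pb_lift_snd Q _) _) |].
    exact (f_equal (lax_fun (pb_snd Q)) (lax_hom_app (pb_lift_snd (pb p (p ∘ pb_fst Q)) _) y)). }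
  assert (pt : forall y, {z : pb_obj P |
    lax_fun (pb_fst P) z = s (lax_fun (slice_map Y) y) /\ lax_fun (pb_snd P) z = y /\
    lax_map (slice_dom Y) y ≤ lax_map (pb_obj P) z}).
  { intros y. apply constructive_indefinite_description.
    apply (pb_point P); [apply ps | | reflexivity].
    transitivity (lax_map B (lax_fun (slice_map Y) y)); [apply lax_le | apply le_s]. }
  pose (g := fun y => lax_fun (pb_snd Q) (lax_fun k (proj1_sig (pt y)))).
  assert (gE : forall z, g (lax_fun (pb_snd P) z) = lax_fun (pb_snd Q) (lax_fun k z))
    by (intros z; apply k_snd, (proj2_sig (pt (lax_fun (pb_snd P) z)))).
  assert (g_mono : forall y y', y ≤ y' -> g y ≤ g y').
  { intros y y' hy.
    (* The section need not be monotone; [gE] allows [g] to be computed at the ordered lifts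
       [e ≤ e'] instead. *)
    destruct (ordered _ _ (monotone_le (lax_fun (slice_map Y)) hy))
      as [e [e' [he [He He']]]].
    destruct (pb_meet_point hX P He) as [z [z1 [z2 _]]].
    destruct (pb_meet_point hX P He') as [z' [z1' [z2' _]]].
    rewrite <- z2, <- z2', !gE. do 2 apply monotone_le.
    apply (pb_le hX); congruence. }
  assert (g_lax : forall y,
    lax_map (slice_dom Y) y ≤ lax_map (slice_dom Z) (Monotone g_mono y)).
  { intros y. destruct (proj2_sig (pt y)) as [_ [_ hz]].
    refine (transitivity hz _).
    refine (transitivity (lax_le k _) _). exact (lax_le (pb_snd Q) _). }
  pose (gh := LaxHom g_lax : hom (slice_dom Y) (slice_dom Z)).
  assert (g_over : slice_map Z ∘ gh = slice_map Y).
  { apply lax_hom_eq. intros y.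
    etransitivity; [symmetry; exact (lax_hom_app (pb_comm Q) _) |].
    change (lax_fun p (lax_fun (pb_fst Q) (lax_fun k (proj1_sig (pt y)))) =
      lax_fun (slice_map Y) y).
    rewrite k_over, (proj1 (proj2_sig (pt y))). apply ps. }
  exists (SliceHom g_over).
  apply algebra_hom_eq, slice_hom_eq.
  apply (pb_unique (p := Q)); apply lax_hom_eq; intros z.
  - etransitivity; [exact (lax_hom_app (pb_lift_fst Q _) z) |]. symmetry. apply k_over.
  - etransitivity; [exact (lax_hom_app (pb_lift_snd Q _) z) |]. apply gE.
Qed.

End Comparison.

(** * Effective descent from the three properties of the comparison functor *)

Theorem theorem5p2
    (X : preorder) (hX : locally_complete X)
    (E B : lax_comma X) (p : hom E B)
    (ha : forall b2 b1 b0 : lax_dom B, b2 ≤ b1 -> b1 ≤ b0 ->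
      exists e2 e1 e0 : lax_dom E, e2 ≤ e1 /\ e1 ≤ e0 /\
        lax_fun p e2 = b2 /\ lax_fun p e1 = b1 /\ lax_fun p e0 = b0)
    (hb : forall (x : X) (b1 b0 : lax_dom B),
      b1 ≤ b0 -> x ≤ lax_map B b1 ->
      exists e1 e0 : lax_dom E, e1 ≤ e0 /\ x ≤ lax_map E e1 /\
        lax_fun p e1 = b1 /\ lax_fun p e0 = b0) :
  effective_descent p.
Proof.
  split; [now apply lax_comma_has_pullbacks |]. intros pb.
  assert (sec : forall b : lax_dom B,
    {e : lax_dom E | lax_fun p e = b /\ lax_map B b ≤ lax_map E e}).
  { intros b. apply constructive_indefinite_description.
    destruct (hb _ _ _ (reflexivity b) (reflexivity (lax_map B b)))
      as [e [_ [_ [he [pe _]]]]].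
    now exists e. }
  pose (s := fun b => proj1_sig (sec b)).
  assert (ps : forall b, lax_fun p (s b) = b)
    by (intros b; exact (proj1 (proj2_sig (sec b)))).
  assert (le_s : forall b, lax_map B b ≤ lax_map E (s b))
    by (intros b; exact (proj2 (proj2_sig (sec b)))).
  apply equivalence_of_full_faithful_eso.
  - intros Y Z h. apply comparison_full with s; trivial.
    intros b1 b0 hb10.
    destruct (hb _ _ _ hb10 (reflexivity (lax_map B b1))) as [e1 [e0 [he [_ [p1 p0]]]]].
    now exists e1, e0.
  - intros Y Z f g. apply comparison_faithful; trivial. intros b. now exists (s b).
  - intros A. now apply comparison_eso with s.
Qed.
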